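(* Let $m\ge1$, $k\ge1$ and $h\le k-1$ be integers. The generating function for the number of partitions $\lambda$ of $n$ into distinct odd parts with an $h$-fixed hook in the $m$th column that arises from a hook of size $k$ (i.e. the row $s=k-h$ satisfies $\lambda_s\ge m$ and $h_{s,m}(\lambda)=k$) is \[ \sum_{\substack{l=\lceil\frac{2k-1}{3}\rceil\\ l\ \mathrm{odd}}}^{k}\frac{q^{(m-1)(2k-h-l)+k+l(k-h-1)+2\binom{k-h}{2}+2\binom{k-l}{2}}\,(-q;q^2)_{\frac{m-1}{2}}}{(q^2;q^2)_{k-h-1}}\binom{k-l+\frac{3l-2k-1}{2}}{k-l}_{q^2} \] if $m$ is odd, and \[ \sum_{\substack{l=\lceil\frac{2k}{3}\rceil\\ l\ \mathrm{even}}}^{k}\frac{q^{k-l+(m-1)(2k-h-l)+k+l(k-h-1)+2\binom{k-h}{2}+2\binom{k-l}{2}}\,(-q;q^2)_{\frac{m}{2}}}{(q^2;q^2)_{k-h-1}}\binom{k-l+\frac{3l-2k-2}{2}}{k-l}_{q^2} \] if $m$ is even.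
   Context: For a partition $\lambda$ with conjugate $\lambda'$, $h_{i,j}(\lambda)=\lambda_i+\lambda'_j-i-j+1$ is the hook length of cell $(i,j)$, $j\le\lambda_i$. An $h$-fixed hook in the $m$th column is a row $i$ with $\lambda_i\ge m$ and $h_{i,m}(\lambda)=i+h$. Notation: $(a;b)_n=\prod_{t=0}^{n-1}(1-ab^t)$; $\binom{x}{2}=x(x-1)/2$; $\binom{a}{b}_{q^2}$ is the Gaussian binomial coefficient $\frac{(q;q)_a}{(q;q)_b(q;q)_{a-b}}$ with $q$ replaced by $q^2$, taken to be $0$ unless $0\le b\le a$. *)

(* Defs.v *)
From HB Require Import structures.
From mathcomp Require Import all_boot all_order all_algebra.

Set Implicit Arguments.
Unset Strict Implicit.
Unset Printing Implicit Defensive.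

Import Order.TTheory GRing.Theory Num.Theory.
Local Open Scope ring_scope.

(* A partition is the sequence of its parts in weakly decreasing order. *)
Definition is_partition (n : nat) (la : seq nat) : bool :=
  [&& sorted geq la, 0%N \notin la & sumn la == n].

Definition distinct_odd_parts (la : seq nat) : bool := uniq la && all odd la.

(* [part la i] is lambda_i and [conj_part la j] is lambda'_j; rows and columns
   are numbered from 1, and lambda_i = 0 beyond the number of parts. *)
Definition part (la : seq nat) (i : nat) : nat := nth 0%N la i.-1.

Definition conj_part (la : seq nat) (j : nat) : nat :=
  count (fun x => (j <= x)%N) la.

Definition hook_length (la : seq nat) (i j : nat) : int :=
  (part la i)%:Z + (conj_part la j)%:Z - i%:Z - j%:Z + 1.

Definition fixed_hook (h : int) (m : nat) (la : seq nat) (i : nat) : bool :=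
  [&& (1 <= i)%N, (m <= part la i)%N & hook_length la i m == i%:Z + h].

(* For m >= 1, lambda_i >= m forces i <= size la, so the range of i is no
   restriction. *)
Definition has_fixed_hook_of_size (h : int) (m k : nat) (la : seq nat) : bool :=
  has (fun i => fixed_hook h m la i && (hook_length la i m == k%:Z))
      (iota 1 (size la)).

(* A partition of n has at most n parts, each at most n (see [partition_size]
   and [partition_part]), so it is found exactly once in this finite type. *)
Definition num_partitions (P : pred (seq nat)) (n : nat) : nat :=
  #|[set la : n.-bseq 'I_n.+1 |
      let s := [seq nat_of_ord x | x <- la] in is_partition n s && P s]|.

Lemma partition_size n la : is_partition n la -> (size la <= n)%N.
Proof.
case/and3P=> _ + /eqP <-; elim: la => //= x s IHs.
rewrite inE negb_or eq_sym -lt0n => /andP[x_gt0 /IHs IH].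
by rewrite -add1n leq_add.
Qed.

Lemma partition_part n la x : is_partition n la -> x \in la -> (x <= n)%N.
Proof.
case/and3P=> _ _ /eqP <-; elim: la => //= y s IHs.
rewrite inE => /orP[/eqP->|/IHs le_x]; first exact: leq_addr.
exact: leq_trans le_x (leq_addl _ _).
Qed.

Local Notation "x %:F" := (tofrac x) : ring_scope.

Definition ratfun := {fraction {poly rat}}.

Definition q : ratfun := 'X%:F.

(* The rational function F is the formal power series sum_n (c n) q^n: it can
   be written p / d with d(0) <> 0, and d times the series is p. *)
Definition has_expansion (F : ratfun) (c : nat -> rat) : Prop :=
  exists p d : {poly rat},
    [/\ d`_0 != 0, F = p%:F / d%:F
      & forall n : nat, \sum_(i < n.+1) d`_i * c (n - i)%N = p`_n].

Definition is_generating_function (c : nat -> nat) (F : ratfun) : Prop :=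
  has_expansion F (fun n => (c n)%:R).

Lemma has_expansion_unique F c1 c2 :
  has_expansion F c1 -> has_expansion F c2 -> c1 =1 c2.
Proof.
move=> [p1 [d1 [d1n0 -> E1]]] [p2 [d2 [d2n0 F2 E2]]].
have nz (d : {poly rat}) : d`_0 != 0 -> d%:F != 0 :> ratfun.
  by move=> dn0; rewrite tofrac_eq0; apply: contraNneq dn0 => ->; rewrite coef0.
have Ep : p1 * d2 = p2 * d1.
  apply/eqP; rewrite -tofrac_eq !tofracM; apply/eqP.
  by have /eqP := F2; rewrite eqr_div ?nz // => /eqP.
pose T N (c : nat -> rat) : {poly rat} := \poly_(i < N.+1) c i.
have key N (p d : {poly rat}) c :
    (forall n : nat, \sum_(i < n.+1) d`_i * c (n - i)%N = p`_n) ->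
  forall n, (n <= N)%N -> (d * T N c)`_n = p`_n.
  move=> E n le_n; rewrite -E coefM; apply: eq_bigr => i _.
  by rewrite coef_poly ltnS (leq_trans (leq_subr _ _) le_n).
have keyM N (u v w : {poly rat}) :
    (forall n, (n <= N)%N -> u`_n = v`_n) ->
  forall n, (n <= N)%N -> (w * u)`_n = (w * v)`_n.
  move=> E n le_n; rewrite !coefM; apply: eq_bigr => i _.
  by rewrite E // (leq_trans (leq_subr _ _) le_n).
have D N n : (n <= N)%N -> (d1 * d2 * (T N c1 - T N c2))`_n = 0.
  move=> le_n; rewrite mulrBr coefB [X in X * T N c1]mulrC -!mulrA.
  rewrite (keyM N _ _ d2 (key N _ _ _ E1)) // (keyM N _ _ d1 (key N _ _ _ E2)) //.
  by rewrite mulrC Ep mulrC subrr.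
move=> n; elim/ltn_ind: n => n IHn.
have := D n n (leqnn n).
rewrite coefM big_ord_recl subn0 big1 => [|i _].
  rewrite addr0 coefB !coef_poly ltnSn => /eqP.
  rewrite coefM big_ord1 mulf_eq0 mulf_eq0 (negPf d1n0) (negPf d2n0) /=.
  by rewrite subr_eq0 => /eqP.
rewrite /= coefB !coef_poly; case: ifP => _; last by rewrite subrr mulr0.
have lt_n : (n - bump 0 i < n)%N.
  by rewrite ltn_subrL /= (leq_ltn_trans _ (ltn_ord i)).
by rewrite IHn // subrr mulr0.
Qed.

(* (a; b)_n *)
Definition qpoch (a b : ratfun) (n : nat) : ratfun :=
  \prod_(t < n) (1 - a * b ^+ t).

(* The Gaussian binomial coefficient with q replaced by x. *)
Definition gauss_binom (x : ratfun) (a b : int) : ratfun :=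
  if (0 <= b) && (b <= a)
  then qpoch x x (absz a) / (qpoch x x (absz b) * qpoch x x (absz (a - b)%R))
  else 0.

Definition binom2 (x : int) : int := ((x * (x - 1)) %/ 2)%Z.

Definition ceil_div (a b : nat) : nat := ((a + b.-1) %/ b)%N.

(* In the next two definitions 1 <= l <= k, k - h - 1 >= 0, and the parity of
   m and l makes all divisions by 2 exact. *)
Definition term_odd (m k : nat) (h : int) (l : nat) : ratfun :=
  q ^ ((m%:Z - 1) * (2 * k%:Z - h - l%:Z) + k%:Z + l%:Z * (k%:Z - h - 1)
       + 2 * binom2 (k%:Z - h) + 2 * binom2 (k%:Z - l%:Z))
  * qpoch (- q) (q ^+ 2) ((m - 1) %/ 2)%N
  / qpoch (q ^+ 2) (q ^+ 2) (absz (k%:Z - h - 1)%R)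
  * gauss_binom (q ^+ 2)
      (k%:Z - l%:Z + ((3 * l%:Z - 2 * k%:Z - 1) %/ 2)%Z) (k%:Z - l%:Z).

Definition term_even (m k : nat) (h : int) (l : nat) : ratfun :=
  q ^ (k%:Z - l%:Z
       + (m%:Z - 1) * (2 * k%:Z - h - l%:Z) + k%:Z + l%:Z * (k%:Z - h - 1)
       + 2 * binom2 (k%:Z - h) + 2 * binom2 (k%:Z - l%:Z))
  * qpoch (- q) (q ^+ 2) (m %/ 2)%N
  / qpoch (q ^+ 2) (q ^+ 2) (absz (k%:Z - h - 1)%R)
  * gauss_binom (q ^+ 2)
      (k%:Z - l%:Z + ((3 * l%:Z - 2 * k%:Z - 2) %/ 2)%Z) (k%:Z - l%:Z).

(* Main.v *)
(* Put s + 1 = k - h and let x be the part in row s + 1.  The partition is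
   u ++ x :: v ++ w, where u consists of s odd parts larger than x, v of t parts
   in [m, x), and w of parts smaller than m; the hook condition reads
   (x - m + 1) + t = k, so that l = x - m + 1 is the arm plus one and t = k - l
   is the leg.  Distinct parts taken from an arithmetic progression are counted
   by an elementary symmetric polynomial in powers of q, which is a Gaussian
   binomial in q^2: this accounts for v, and in the limit of an infinite
   progression it gives the factor 1 / (q^2;q^2)_s for u.  The parts of w
   contribute (-q;q^2) of length m / 2 rounded down. *)
Require Import Defs.
From mathcomp Require Import all_boot all_order all_algebra.
From mathcomp Require Import zify ring.

Set Implicit Arguments.
Unset Strict Implicit.
Unset Printing Implicit Defensive.

Import Order.TTheory GRing.Theory Num.Theory.
Local Open Scope ring_scope.

(** * Generating functions over subsequences, weighted by the sum of the entries *)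

Fixpoint subseqs (L : seq nat) : seq (seq nat) :=
  if L is x :: L' then subseqs L' ++ [seq x :: u | u <- subseqs L']
  else [:: [::]].

Lemma mem_subseqs L u : (u \in subseqs L) = subseq u L.
Proof.
elim: L u => [|x L IHL] [|y u] //=; rewrite mem_cat IHL ?sub0seq //.
case: eqP => [->|ne_yx]; last first.
  by case: (boolP (subseq _ L)) => //= _; apply/negbTE/mapP=> -[v _ [/ne_yx]].
rewrite mem_map => [|v w [] //]; rewrite IHL orb_idl // => /(subseq_trans _) -> //.
exact: subseq_cons.
Qed.

Lemma subseqs_uniq L : uniq L -> uniq (subseqs L).
Proof.
elim: L => //= x L IHL /andP[xL /IHL uL]; rewrite cat_uniq uL.
rewrite map_inj_uniq ?uL ?andbT => [|v w [] //].
apply/hasPn=> _ /mapP[v _ ->]; rewrite mem_subseqs.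
by apply: contra xL => /mem_subseq -> //; rewrite mem_head.
Qed.

(** The weight [f] is polynomial-valued so that, in [subseq_sum_cat], the sum over the second block
    can serve as the weight for the first. *)
Definition subseq_sum (L : seq nat) (f : seq nat -> {poly rat}) : {poly rat} :=
  \sum_(u <- subseqs L) 'X^(sumn u) * f u.

Lemma subseq_sum_nil f : subseq_sum [::] f = f [::].
Proof. by rewrite /subseq_sum big_seq1 expr0 mul1r. Qed.

Lemma subseq_sum_cons x L f :
  subseq_sum (x :: L) f
  = subseq_sum L f + 'X^x * subseq_sum L (fun u => f (x :: u)).
Proof.
rewrite /subseq_sum big_cat big_map mulr_sumr; congr (_ + _).
by apply: eq_bigr => u _; rewrite exprD mulrA.
Qed.

Lemma eq_subseq_sum L f g :
  (forall u, subseq u L -> f u = g u) -> subseq_sum L f = subseq_sum L g.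
Proof. by move=> fg; apply: eq_big_seq => u; rewrite mem_subseqs => /fg ->. Qed.

Lemma subseq_sum_cat L1 L2 f :
  subseq_sum (L1 ++ L2) f
  = subseq_sum L1 (fun u => subseq_sum L2 (fun v => f (u ++ v))).
Proof.
elim: L1 f => [|x L IHL] f; first by rewrite subseq_sum_nil.
by rewrite cat_cons !subseq_sum_cons !IHL.
Qed.

Lemma subseq_sumZ L f c : subseq_sum L (fun u => f u * c) = subseq_sum L f * c.
Proof. by rewrite /subseq_sum mulr_suml; apply: eq_bigr => u _; rewrite mulrA. Qed.

Lemma subseq_sum0 L : subseq_sum L (fun=> 0) = 0.
Proof. by rewrite /subseq_sum big1 // => u _; rewrite mulr0. Qed.

Lemma coef_subseq_sum L (P : pred (seq nat)) n :
  (subseq_sum L (fun u => (P u)%:R))`_n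
  = (count (fun u => (sumn u == n) && P u) (subseqs L))%:R.
Proof.
rewrite /subseq_sum coef_sum -sum1_count natr_sum [RHS]big_mkcond.
apply: eq_bigr => u _; case: (P u); rewrite ?andbT ?andbF ?mulr0 ?coef0 //.
by rewrite mulr1 coefXn eq_sym; case: eqP.
Qed.

(** * Elementary symmetric polynomials evaluated at powers of the variable *)

Definition esym (j : nat) (L : seq nat) : {poly rat} :=
  subseq_sum L (fun u => (size u == j)%:R).

Lemma esym0 L : esym 0 L = 1.
Proof.
elim: L => [|x L IHL]; rewrite /esym ?subseq_sum_nil // subseq_sum_cons /=.
by rewrite subseq_sum0 mulr0 addr0.
Qed.

Lemma esymS j x L : esym j.+1 (x :: L) = esym j.+1 L + 'X^x * esym j L.
Proof. by rewrite /esym subseq_sum_cons. Qed.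

(** Decreasing order makes subsequences appear in the order of the parts of a partition. *)
Fixpoint downseq (a n : nat) : seq nat :=
  if n is n'.+1 then (a + n'.*2)%N :: downseq a n' else [::].

Lemma downseq_cat a b n :
  downseq a (b + n) = downseq (a + b.*2) n ++ downseq a b.
Proof.
by elim: n => [|n IHn]; rewrite ?addn0 // addnS /= IHn doubleD addnA.
Qed.

Lemma mem_downseq a n x :
  (x \in downseq a n) = [&& a <= x, x < a + n.*2 & odd x == odd a]%N.
Proof.
elim: n => [|n IHn] /=; first by rewrite in_nil; lia.
by rewrite inE IHn; lia.
Qed.

Lemma downseq_sorted a n : sorted gtn (downseq a n).
Proof.
elim: n => //= n; case: n => //= n IHn; rewrite IHn andbT.
by rewrite ltn_add2l ltn_double.
Qed.

(** Induction on [n] by the q-Pascal rule: with denominators cleared, this evaluates [esym] as a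
    power of q times a Gaussian binomial in q^2. For [j > n] both sides vanish. *)
Lemma esym_downseq j a n :
  esym j (downseq a n) * \prod_(t < j) (1 - 'X^(t.+1.*2))
  = 'X^(j * a + j * j.-1) * \prod_(t < j) (1 - 'X^((n - t).*2)).
Proof.
elim: n j => [|n IHn] [|j].
- by rewrite esym0 !big_ord0 expr0 !mulr1.
- by rewrite /esym subseq_sum_nil mul0r big_ord_recl subrr mul0r mulr0.
- by rewrite esym0 !big_ord0 expr0 !mulr1.
rewrite esymS mulrDl IHn [in X in _ + X]big_ord_recr [esym j _]lock /=.
rewrite (mulrA (_ * _)) -(mulrA 'X^_) -lock IHn.
rewrite [in LHS]big_ord_recr big_ord_recl /=.
under [X in _ = _ * (_ * X)]eq_bigr do rewrite subSS.
have [le_jn|lt_nj] := leqP j n; last first.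
  (* the factor t = n vanishes *)
  suff -> : \prod_(t < j) (1 - 'X^((n - t).*2)) = 0 :> {poly rat} by ring.
  by rewrite (bigD1 (Ordinal lt_nj)) //= subnn subrr mul0r.
have -> : (j.+1 * a + j.+1 * j = (j * a + j * j.-1) + (a + j.*2))%N by nia.
have En : 'X^(n.*2) = 'X^(j.*2) * 'X^((n - j).*2) :> {poly rat}.
  by rewrite -exprD -doubleD subnKC.
rewrite subn0 !doubleS !exprD !exprS En; ring.
Qed.

(* The j-th summand collects the subsequences whose s-th entry is
   [a + j.*2]. *)
Lemma subseq_sum_nth s a n (F : nat -> nat -> {poly rat}) :
  subseq_sum (downseq a n)
    (fun u => if (s < size u)%N then F (nth 0%N u s) (size u - s.+1)%N else 0)
  = \sum_(j < n) esym s (downseq (a + j.+1.*2) (n - j.+1)) *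
      ('X^(a + j.*2) * subseq_sum (downseq a j) (fun v => F (a + j.*2)%N (size v))).
Proof.
elim: n s => [|n IHn] s; first by rewrite subseq_sum_nil big_ord0.
rewrite /= subseq_sum_cons IHn big_ord_recr /= subnn.
case: s => [|s] /=.
  rewrite !esym0 mul1r; congr (_ + _); first by apply: eq_bigr => j _; rewrite !esym0.
  by congr (_ * _); apply: eq_subseq_sum => u _; rewrite subSS subn0.
rewrite [esym s.+1 [::]]subseq_sum_nil mul0r addr0 IHn mulr_sumr -big_split /=.
apply: eq_bigr => j _; rewrite subSS -[(n - j)%N]prednK ?subn_gt0 // -subnS /= esymS.
have -> : (a + j.+1.*2 + (n - j.+1).*2 = a + n.*2)%N by have := ltn_ord j; lia.
ring.
Qed.

(** * Partitions into distinct odd parts as subsequences of a progression *)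

Lemma gtn_trans : transitive gtn.
Proof. exact: rev_trans ltn_trans. Qed.

Lemma subseq_downseq a n u :
  subseq u (downseq a n)
  = sorted gtn u && all (fun x => [&& a <= x, x < a + n.*2 & odd x == odd a]%N) u.
Proof.
apply/idP/andP => [sub|[su /allP au]].
  split; first exact: subseq_sorted gtn_trans _ _ sub (downseq_sorted a n).
  by apply/allP=> x /(mem_subseq sub); rewrite mem_downseq.
(* A strictly decreasing list is determined by its set of members. *)
suff -> : u = [seq x <- downseq a n | x \in u] by apply: filter_subseq.
apply: (irr_sorted_eq gtn_trans) => //; first by move=> x /=; rewrite ltnn.
  exact: sorted_filter gtn_trans _ _ (downseq_sorted a n).
move=> x; rewrite mem_filter; case: (boolP (x \in u)) => //= /au.
by rewrite mem_downseq.
Qed.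

(** Parts of a partition of [n] are at most [n < 2M], so the odd numbers 1, ..., 2M - 1 provide all
    of them. *)
Lemma num_partitions_coef (P : pred (seq nat)) n M : (n < M.*2)%N ->
  (num_partitions (fun la => distinct_odd_parts la && P la) n)%:R
  = (subseq_sum (downseq 1 M) (fun u => (P u)%:R))`_n.
Proof.
move=> lt_nM; rewrite coef_subseq_sum; congr _%:R.
pose g (la : n.-bseq 'I_n.+1) := [seq nat_of_ord x | x <- la].
have g_inj : injective g by move=> x y /(inj_map val_inj) /val_inj.
rewrite /num_partitions cardE -(size_map g) -size_filter.
apply/perm_size/uniq_perm.
- by rewrite map_inj_uniq ?enum_uniq.
- apply/filter_uniq/subseqs_uniq/(sorted_uniq gtn_trans _ (downseq_sorted 1 M)).
  by move=> x /=; rewrite ltnn.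
move=> u; rewrite mem_filter mem_subseqs subseq_downseq.
transitivity (is_partition n u && (distinct_odd_parts u && P u)).
  apply/mapP/idP => [[la]|Pu].
    by rewrite mem_enum inE => Pla ->.
  have /andP[pu _] := Pu.
  have szu : (size (map (@inord n) u) <= n)%N.
    by rewrite size_map; apply: partition_size pu.
  have gu : g (Bseq szu) = u.
    rewrite /g /= -map_comp map_id_in // => x /(partition_part pu) le_xn.
    by rewrite /= inordK.
  by exists (Bseq szu); rewrite // mem_enum inE -/(g _) gu.
rewrite gtn_sorted_uniq_geq /is_partition /distinct_odd_parts.
case: eqP => [sum_u|]; rewrite ?andbF //=.
suff -> : all (fun x => [&& 0 < x, x < 1 + M.*2 & odd x == true]%N) u
    = (0%N \notin u) && all odd u.
  by case: (sorted _ _); case: (uniq _); case: (_ \notin _); case: (all _ _);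
    case: (P u).
apply/allP/andP => [bu|[_ /allP ou] x xu].
  by split; [apply/negP => /bu | apply/allP=> x /bu]; lia.
have le_xn : (x <= n)%N.
  rewrite -sum_u; elim: u xu {sum_u ou} => //= y v IHv.
  by rewrite inE => /orP[/eqP->|/IHv]; lia.
have := ou x xu; lia.
Qed.

(** * The hook condition and the decomposition around its row *)

Lemma has_fixed_hook_cat (h : int) m k s u w : (0 < m)%N -> k%:Z - h = s.+1%:Z ->
    all (leq m) u -> all (gtn m) w ->
  has_fixed_hook_of_size h m k (u ++ w)
  = (s < size u)%N && (nth 0%N u s + (size u - s.+1) + 1 == m + k)%N.
Proof.
move=> m_gt0 kh /allP um /allP wm.
(* Column [m] meets exactly the rows of [u]. *)
have conjE : conj_part (u ++ w) m = size u.
  rewrite /conj_part count_cat (@eq_in_count _ _ predT u) ?count_predT.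
    by rewrite (@eq_in_count _ _ pred0 w) ?count_pred0 ?addn0 // => x /wm /=; lia.
  by move=> x /um.
have partE i : (0 < i)%N -> (m <= part (u ++ w) i)%N = (i <= size u)%N.
  move=> i_gt0; rewrite /part nth_cat; case: ifP => lt_iu.
    by rewrite (um _ (mem_nth 0%N lt_iu)); lia.
  have [lt_iw|] := ltnP (i.-1 - size u) (size w).
    by have := wm _ (mem_nth 0%N lt_iw) => /=; lia.
  by move=> /(nth_default 0%N) ->; lia.
rewrite /has_fixed_hook_of_size; apply/hasP/andP => [[i _]|[lt_su /eqP hk]].
  case/andP=> /and3P[i_gt0]; rewrite partE // => le_iu /eqP hi /eqP hk.
  (* The hook equals both [i + h] and [k], which fixes the row. *)
  have Ei : i = s.+1 by lia.
  move: hk; rewrite /hook_length conjE {}Ei /part nth_cat /= in le_iu *.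
  by rewrite le_iu; lia.
exists s.+1; first by rewrite mem_iota size_cat; lia.
rewrite /fixed_hook partE //= lt_su.
suff -> : hook_length (u ++ w) s.+1 m = k%:Z by lia.
by rewrite /hook_length conjE /part nth_cat /= lt_su; lia.
Qed.

Lemma subseq_sum_odds b :
  subseq_sum (downseq 1 b) (fun=> 1) = \prod_(t < b) (1 + 'X^(t.*2.+1)).
Proof.
elim: b => [|b IHb]; first by rewrite subseq_sum_nil big_ord0.
by rewrite subseq_sum_cons IHb big_ord_recr /= add1n; ring.
Qed.

(** Here [a] is the least odd number not below [m]. The part [a + 2j] in row [s + 1] gives l = 2j +
    1, plus 1 if [m] is even, and the leg must be k - l; the condition l <= k guards this truncated
    subtraction. *)
Lemma subseq_sum_hook (h : int) m k s n : (0 < m)%N -> k%:Z - h = s.+1%:Z ->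
  let a := (m + ~~ odd m)%N in
  subseq_sum (downseq 1 (m./2 + n)) (fun la => (has_fixed_hook_of_size h m k la)%:R)
  = \sum_(j < n | (j.*2.+1 + ~~ odd m <= k)%N)
      esym s (downseq (a + j.+1.*2) (n - j.+1)) *
      ('X^(a + j.*2) * esym (k - (j.*2.+1 + ~~ odd m)) (downseq a j)) *
      \prod_(t < m./2) (1 + 'X^(t.*2.+1)).
Proof.
move=> m_gt0 kh a; have aE : (1 + m./2.*2 = a)%N by rewrite /a; lia.
pose F (x t : nat) : {poly rat} := (x + t + 1 == m + k)%N%:R.
rewrite downseq_cat aE subseq_sum_cat.
transitivity (subseq_sum (downseq a n) (fun u =>
    (if (s < size u)%N then F (nth 0%N u s) (size u - s.+1)%N else 0) *
    \prod_(t < m./2) (1 + 'X^(t.*2.+1)))).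
  apply: eq_subseq_sum => u /mem_subseq su.
  rewrite -subseq_sum_odds mulrC -subseq_sumZ; apply: eq_subseq_sum => w /mem_subseq sw.
  rewrite (has_fixed_hook_cat m_gt0 kh) ?mul1r.
  - by rewrite /F; case: ifP.
  - by apply/allP=> x /su; rewrite mem_downseq /=; lia.
  - by apply/allP=> x /sw; rewrite mem_downseq /=; lia.
rewrite subseq_sumZ subseq_sum_nth mulr_suml [RHS]big_mkcond.
apply: eq_bigr => j _; case: ifP => le_jk.
  congr (_ * (_ * _) * _); apply: eq_subseq_sum => v _.
  by rewrite /F; congr (nat_of_bool _)%:R; lia.
(* When l > k, no leg length satisfies the hook equation. *)
rewrite (@eq_subseq_sum _ _ (fun=> 0)) ?subseq_sum0 ?mulr0 ?mul0r // => v _.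
by rewrite /F; case: eqP => //; lia.
Qed.

(** * The generating function as a fraction, by truncating the infinite progression *)

Lemma coef_mul_prod_1subXn N s (e : nat -> nat) (U : {poly rat}) :
    (forall t, (t < s)%N -> (N < e t)%N) ->
  (U * \prod_(t < s) (1 - 'X^(e t)))`_N = U`_N.
Proof.
elim: s => [|s IHs] lt_Ne; first by rewrite big_ord0 mulr1.
rewrite big_ord_recr mulrA mulrBr mulr1 coefB coefMXn lt_Ne // subr0.
by apply: IHs => t /leqW /lt_Ne.
Qed.

Definition qfact (s : nat) : {poly rat} := \prod_(t < s) (1 - 'X^(t.+1.*2)).

Lemma qfact_coef0 s : (qfact s)`_0 = 1.
Proof.
by rewrite -[qfact s]mul1r (coef_mul_prod_1subXn (e := fun t => t.+1.*2)) ?coef1.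
Qed.

(* The numerator contributed by the partitions whose hook has arm length
   l - 1, where l = 2j + 1 for odd m and l = 2j + 2 for even m. *)
Definition hook_poly (m k s j : nat) : {poly rat} :=
  let a := (m + ~~ odd m)%N in
  'X^(s * (a + j.+1.*2) + s * s.-1 + (a + j.*2)) *
  esym (k - (j.*2.+1 + ~~ odd m)) (downseq a j) *
  \prod_(t < m./2) (1 + 'X^(t.*2.+1)).

(** For each coefficient [N] a long enough finite progression suffices: [esym_downseq] turns
    [qfact s] times [esym s] into a monomial times factors 1 - X^e with e > N, which leave that
    coefficient unchanged. *)
Lemma hook_generating_function (h : int) m k s :
    (0 < m)%N -> (0 < k)%N -> k%:Z - h = s.+1%:Z ->
  is_generating_function
    (num_partitions
      (fun la => distinct_odd_parts la && has_fixed_hook_of_size h m k la))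
    (tofrac (\sum_(j < k | (j.*2.+1 + ~~ odd m <= k)%N) hook_poly m k s j)
     / tofrac (qfact s)).
Proof.
move=> m_gt0 k_gt0 kh; set p := \sum_(j < k | _) _.
exists p, (qfact s); split=> // [|N]; first by rewrite qfact_coef0 oner_neq0.
(* This length makes every exponent 2(n - j - 1 - t) with j < k and t < s exceed [N]. *)
pose n := (k + (N + s))%N; pose M := (m./2 + n)%N.
transitivity (qfact s * subseq_sum (downseq 1 M)
                (fun la => (has_fixed_hook_of_size h m k la)%:R))`_N.
  rewrite coefM; apply: eq_bigr => i _; congr (_ * _).
  by apply: num_partitions_coef; rewrite /M /n; lia.
rewrite (subseq_sum_hook n m_gt0 kh) mulr_sumr /p !coef_sum.
rewrite (big_ord_widen_cond n (fun j => j.*2.+1 + ~~ odd m <= k)%N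
           (fun j => (hook_poly m k s j)`_N)) ?leq_addr //.
apply: eq_big => j; first by lia.
move=> le_jk; set a := (m + _)%N; set V := esym (k - _) _; set L := \prod_(_ < m./2) _.
set U := esym s _.
have -> : qfact s * (U * ('X^(a + j.*2) * V) * L)
    = (U * qfact s) * ('X^(a + j.*2) * V * L) by ring.
rewrite esym_downseq mulrAC.
rewrite (coef_mul_prod_1subXn (e := fun t => (n - j.+1 - t).*2)) => [|t lt_ts].
  by rewrite /hook_poly -/a -/V -/L [in RHS]exprD !mulrA.
have : (j < k)%N by lia.
by rewrite /n; move: (nat_of_ord j) lt_ts; clear; lia.
Qed.

(** * Translation into q-Pochhammer symbols and Gaussian binomials *)

Lemma qpoch_qfact n : qpoch (q ^+ 2) (q ^+ 2) n = tofrac (qfact n).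
Proof.
rewrite /qpoch /qfact rmorph_prod; apply: eq_bigr => t _.
by rewrite rmorphB rmorph1 rmorphXn /= -exprS -exprM mul2n.
Qed.

Lemma qfact_frac_neq0 n : tofrac (qfact n) != 0 :> ratfun.
Proof.
rewrite tofrac_eq0; apply: contra_eq_neq (qfact_coef0 n) => ->.
by rewrite coef0 eq_sym oner_neq0.
Qed.

Lemma qfact_falling j t : (t <= j)%N ->
  \prod_(i < t) (1 - 'X^((j - i).*2)) * qfact (j - t) = qfact j.
Proof.
elim: t => [|t IHt] lt_tj; first by rewrite big_ord0 mul1r subn0.
rewrite -IHt 1?ltnW // big_ord_recr /= -mulrA; congr (_ * _).
by rewrite -(subnSK lt_tj) /qfact big_ord_recr /= mulrC.
Qed.

(** Divide [esym_downseq] by (q^2;q^2)_t. For t > j the zero convention of the binomial matches a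
    vanishing factor of the product. *)
Lemma esym_gauss_binom t a j :
  tofrac (esym t (downseq a j))
  = q ^+ (t * a + t * t.-1) * gauss_binom (q ^+ 2) j%:Z t%:Z.
Proof.
have /(congr1 (fun p => tofrac p : ratfun)) := esym_downseq t a j.
rewrite !rmorphM rmorphXn -/(qfact t) /gauss_binom /= lez_nat => E.
apply: (mulIf (qfact_frac_neq0 t)); rewrite {}E -mulrA; congr (_ * _).
case: leqP => [le_tj|lt_jt]; last first.
  by rewrite (bigD1 (Ordinal lt_jt)) //= subnn subrr mul0r rmorph0 mul0r.
rewrite subzn // !absz_nat !qpoch_qfact -(qfact_falling le_tj) rmorphM /=.
rewrite mulrAC -[X in X / _]mulrA [tofrac (qfact (j - t)) * _]mulrC.
by rewrite mulfK ?mulf_neq0 ?qfact_frac_neq0.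
Qed.

Lemma qpoch_odds n :
  qpoch (- q) (q ^+ 2) n = tofrac (\prod_(t < n) (1 + 'X^(t.*2.+1))).
Proof.
rewrite /qpoch rmorph_prod; apply: eq_bigr => t _.
by rewrite rmorphD rmorph1 rmorphXn /= mulNr opprK -exprM mul2n exprS.
Qed.

(** * Matching the exponents and the summation ranges *)

Lemma mul2_binom2 (x : int) : 2 * binom2 x = x * (x - 1).
Proof.
rewrite /binom2 mulrC divzK //.
have [y [->|->]] : exists y, x = 2 * y \/ x = 2 * y + 1.
  by exists (x %/ 2)%Z; lia.
- by rewrite -mulrA dvdz_mulr.
- by rewrite addrK mulrC -mulrA dvdz_mulr.
Qed.

Lemma Posz_muln_pred (n : nat) : (n * n.-1)%N%:Z = n%:Z * (n%:Z - 1).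
Proof. by case: n => //= n; lia. Qed.

(** Substitute l = 2j + 1 + e after lowering the bound [c] to 1, which only adds zero terms; [c > 0]
    keeps l = 0 out in the even case. *)
Lemma sum_nat_parity (V : zmodType) (e : bool) (P : pred nat) c k (g : nat -> V) :
    (forall l, P l = (odd l != e)) -> (0 < c)%N ->
    (forall l, P l -> (l < c)%N -> g l = 0) ->
  \sum_(c <= l < k.+1 | P l) g l
  = \sum_(j < k | (j.*2.+1 + e <= k)%N) g (j.*2.+1 + e)%N.
Proof.
move=> PE c_gt0 g0.
transitivity (\sum_(1 <= l < k.+1 | P l) g l).
  rewrite (big_nat_widenl c 1) // big_mkcondr; apply: eq_bigr => l Pl.
  by case: leqP => // /g0 ->.
rewrite -(big_mkord (fun j => j.*2.+1 + e <= k)%N (fun j => g (j.*2.+1 + e)%N)).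
rewrite -[LHS]big_filter -[RHS]big_filter -(big_map (fun j => j.*2.+1 + e)%N xpredT g).
apply: perm_big; apply: uniq_perm.
- exact/filter_uniq/iota_uniq.
- rewrite map_inj_uniq; last by move=> i j; lia.
  exact/filter_uniq/iota_uniq.
move=> l; rewrite mem_filter mem_index_iota PE.
apply/idP/mapP => [Hl|[j]].
  by exists (l.-1)./2; rewrite ?mem_filter ?mem_index_iota; lia.
by rewrite mem_filter mem_index_iota; lia.
Qed.

Lemma term_oddE m k (h : int) s j :
    odd m -> k%:Z - h = s.+1%:Z -> (j.*2.+1 <= k)%N ->
  term_odd m k h j.*2.+1 = tofrac (hook_poly m k s j) / tofrac (qfact s).
Proof.
move=> m_odd kh le_jk; rewrite /term_odd /hook_poly m_odd !addn0.
have -> : k%:Z - h - 1 = s%:Z by lia.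
have [t kE] : exists t, k = (j.*2.+1 + t)%N by exists (k - j.*2.+1)%N; lia.
have -> : k%:Z - j.*2.+1%:Z = t%:Z by lia.
(* The top entry simplifies to (l - 1)/2 = j, the number of odd values in [m, x). *)
have -> : t%:Z + ((3 * j.*2.+1%:Z - 2 * k%:Z - 1) %/ 2)%Z = j%:Z by lia.
have -> : (k - j.*2.+1 = t)%N by lia.
have -> : ((m - 1) %/ 2 = m./2)%N by lia.
rewrite qpoch_odds qpoch_qfact !mul2_binom2 !rmorphM rmorphXn /= esym_gauss_binom.
rewrite -/q [X in q ^ X](_ : _
  = (s * (m + j.+1.*2) + s * s.-1 + (m + j.*2) + (t * m + t * t.-1))%N%:Z).
  by rewrite -exprnP [in LHS]exprD !mulrA [LHS]mulrAC; congr (_ * _); rewrite mulrAC.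
rewrite !PoszD !Posz_muln_pred kh kE; have -> : h = k%:Z - s.+1%:Z by lia.
by rewrite kE; nia.
Qed.

(** The least odd number above [m] is now [m + 1], so each of the k - l leg parts gains 1; this is
    the extra factor q^(k-l). *)
Lemma term_evenE m k (h : int) s j :
    ~~ odd m -> k%:Z - h = s.+1%:Z -> (j.*2.+2 <= k)%N ->
  term_even m k h j.*2.+2 = tofrac (hook_poly m k s j) / tofrac (qfact s).
Proof.
move=> m_even kh le_jk; rewrite /term_even /hook_poly m_even !addn1.
have -> : k%:Z - h - 1 = s%:Z by lia.
have [t kE] : exists t, k = (j.*2.+2 + t)%N by exists (k - j.*2.+2)%N; lia.
have -> : k%:Z - j.*2.+2%:Z = t%:Z by lia.
have -> : t%:Z + ((3 * j.*2.+2%:Z - 2 * k%:Z - 2) %/ 2)%Z = j%:Z by lia.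
have -> : (k - j.*2.+2 = t)%N by lia.
have -> : (m %/ 2 = m./2)%N by lia.
rewrite qpoch_odds qpoch_qfact !mul2_binom2 !rmorphM rmorphXn /= esym_gauss_binom.
rewrite -/q [X in q ^ X](_ : _
  = (s * (m.+1 + j.+1.*2) + s * s.-1 + (m.+1 + j.*2) + (t * m.+1 + t * t.-1))%N%:Z).
  by rewrite -exprnP [in LHS]exprD !mulrA [LHS]mulrAC; congr (_ * _); rewrite mulrAC.
rewrite !PoszD !Posz_muln_pred kh kE; have -> : h = k%:Z - s.+1%:Z by lia.
by rewrite kE; nia.
Qed.

Theorem theorem3p6 (m k : nat) (h : int) (hm : (1 <= m)%N) (hk : (1 <= k)%N)
    (hh : h <= k%:Z - 1) :
  let count := num_partitions
    (fun la => distinct_odd_parts la && has_fixed_hook_of_size h m k la) in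
  (odd m -> is_generating_function count
     (\sum_(ceil_div (2 * k - 1) 3 <= l < k.+1 | odd l) term_odd m k h l)) /\
  (~~ odd m -> is_generating_function count
     (\sum_(ceil_div (2 * k) 3 <= l < k.+1 | ~~ odd l) term_even m k h l)).
Proof.
have [s kh] : exists s : nat, k%:Z - h = s.+1%:Z by exists (absz (k%:Z - h - 1)%R); lia.
move=> count; have := hook_generating_function hm hk kh; rewrite -/count.
split=> m_par; congr is_generating_function: H; rewrite rmorph_sum mulr_suml m_par.
- rewrite (sum_nat_parity (e := false)) => [|l||l l_odd l_lt].
  + apply: eq_big => j; rewrite addn0 // => le_jk.
    by rewrite (term_oddE m_par kh le_jk).
  + by case: (odd l).
  + by rewrite /ceil_div; lia.
  (* Below the bound 3l < 2k - 1, so the top entry of the binomial is less than k - l. *)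
  rewrite /term_odd /gauss_binom ifF ?mulr0 //; move: l_lt; rewrite /ceil_div; lia.
- rewrite (sum_nat_parity (e := true)) => [|l||l l_even l_lt].
  + apply: eq_big => j; rewrite addn1 // => le_jk.
    by rewrite (term_evenE m_par kh le_jk).
  + by case: (odd l).
  + by rewrite /ceil_div; lia.
  (* Likewise, now from 3l < 2k. *)
  rewrite /term_even /gauss_binom ifF ?mulr0 //; move: l_lt; rewrite /ceil_div; lia.
Qed.
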